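(* Let $M=(J,\Sigma,\mu,\mathcal B)$ be a measurable matroid, given by its family of bases $\mathcal B$, with rank function $r$. Let $$\mathcal B^*=\{B\in\Sigma\mid J\setminus B\in\mathcal B\}.$$ Then $M^*=(J,\Sigma,\mu,\mathcal B^* )$ is a measurable matroid, that is, $\mathcal B^*$ is the family of bases of a measurable matroid on $(J,\Sigma,\mu)$. Its rank function is given by $$r^*(S)=\mu(S)-r(J)+r(J\setminus S)$$ for every $S\in\Sigma$.
   Context: A standard measure space $(J,\Sigma,\mu)$ is a standard Borel space $(J,\Sigma)$ with a finite atomless measure $\mu\colon\Sigma\to[0,\infty)$. Convention: measurable sets are identified when they differ by a $\mu$-null set: $A=B$ means $\mu(A\triangle B)=0$, $A\subseteq B$ means $\mu(A\setminus B)=0$, and families of measurable sets are families in the measure algebra (membership is unaffected by null modifications). All sets are assumed measurable. A set $X$ in a family $\mathcal X$ is maximal in $\mathcal X$ if $X\subseteq Y\in\mathcal X$ implies $Y\subseteq X$. Write $\mathcal X|Z=\{X\in\mathcal X\mid X\subseteq Z\}$. A measurable matroid $(J,\Sigma,\mu,\mathcal F)$ consists of a standard measure space and a family $\mathcal F\subseteq\Sigma$ (the independent sets) satisfying: (I1) $\emptyset\in\mathcal F$; (I2) $F_1\subseteq F_2\in\mathcal F$ implies $F_1\in\mathcal F$; (I3) for all $X\in\Sigma$ and all maximal $F_1,F_2\in\mathcal F|X$, $\mu(F_1)=\mu(F_2)$; (I4) if $(F_i)_{i\in\mathbb N}$ is an increasing sequence in $\mathcal F$, then $\bigcup_i F_i\in\mathcal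 F$. Its rank function is $r(X)=\mu(F)$ for any maximal $F\in\mathcal F|X$ (such $F$ exists and the value does not depend on the choice). Its bases are the maximal members of $\mathcal F$; the family of bases $\mathcal B$ determines $\mathcal F=\{F\in\Sigma\mid F\subseteq B\text{ for some }B\in\mathcal B\}$, so one writes $M=(J,\Sigma,\mu,\mathcal B)$ when the matroid is specified by its bases. *)

(* Defs.v *)
From HB Require Import structures.
From mathcomp Require Import all_boot all_order all_algebra.
From mathcomp Require Import all_classical all_reals all_analysis.

Set Implicit Arguments.
Unset Strict Implicit.
Unset Printing Implicit Defensive.

Import Order.TTheory GRing.Theory Num.Theory.

Local Open Scope classical_set_scope.
Local Open Scope ring_scope.
Local Open Scope ereal_scope.

(* J is isomorphic, as a measurable space, to a Polish space X with its Borel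
   sigma-algebra; a Hausdorff pseudometric space is a metric space. *)
Definition standard_borel (R : realType) (d : measure_display)
    (J : measurableType d) : Prop :=
  exists (X : completePseudoMetricType R) (f : X -> J),
    [/\ hausdorff_space X,
        (exists2 D : set X, countable D & dense D),
        bijective f &
        forall A : set J, measurable A <-> <<s @open X >> (f @^-1` A)].

Section MeasurableMatroid.
Context {R : realType} {d : measure_display} {J : measurableType d}.
Variable mu : set J -> \bar R.

Definition atomless : Prop :=
  forall A : set J, measurable A -> 0 < mu A ->
    exists B : set J, [/\ measurable B, B `<=` A, 0 < mu B & mu B < mu A].

(* Finiteness of mu is carried by its type {finite_measure set J -> \bar R}
   wherever this is used. *)
Definition standard_measure_space : Prop := standard_borel R J /\ atomless.

(* Inclusion in the measure algebra. A family of elements of the measure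
   algebra is represented below by the set of all its measurable
   representatives. *)
Definition ae_subset (A B : set J) : Prop := mu (A `\` B) = 0.

Definition maximal_in (Fam : set (set J)) (A : set J) : Prop :=
  Fam A /\ forall B, Fam B -> ae_subset A B -> ae_subset B A.

Definition restrict_family (Fam : set (set J)) (Z : set J) : set (set J) :=
  [set A | Fam A /\ ae_subset A Z].

(* (I2), read with measure-algebra inclusion, makes Fam stable under null
   modifications: it contains every measurable set a.e. equal to a member. *)
Record measurable_matroid (Fam : set (set J)) : Prop := MeasurableMatroid {
  indep_measurable : Fam `<=` measurable ;
  indep_set0 : Fam set0 ;
  indep_subset : forall A B : set J,
    measurable A -> Fam B -> ae_subset A B -> Fam A ;
  indep_maximal : forall X A B : set J, measurable X ->
    maximal_in (restrict_family Fam X) A ->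
    maximal_in (restrict_family Fam X) B -> mu A = mu B ;
  indep_bigcup : forall A : (set J)^nat,
    (forall i, Fam (A i)) -> (forall i, ae_subset (A i) (A i.+1)) ->
    Fam (\bigcup_i A i)
}.

(* The measure of an arbitrarily chosen maximal member of Fam|X; the default
   value set0 of the choice is irrelevant when Fam is a measurable matroid. *)
Definition rank (Fam : set (set J)) (X : set J) : \bar R :=
  mu (xget set0 [set A | maximal_in (restrict_family Fam X) A]).

Definition bases (Fam : set (set J)) : set (set J) :=
  [set B | maximal_in Fam B].

Definition indep_of_bases (Bs : set (set J)) : set (set J) :=
  [set A | measurable A /\ exists2 B, Bs B & ae_subset A B].

Definition matroid_bases (Bs : set (set J)) : Prop :=
  exists2 Fam, measurable_matroid Fam & bases Fam = Bs.

Definition rank_of_bases (Bs : set (set J)) : set J -> \bar R :=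
  rank (indep_of_bases Bs).

Definition dual_bases (Bs : set (set J)) : set (set J) :=
  [set B | measurable B /\ Bs (~` B)].

End MeasurableMatroid.

(* Main.v *)
Require Import Defs.
From HB Require Import structures.
From mathcomp Require Import all_boot all_order all_algebra.
From mathcomp Require Import all_classical all_reals all_analysis.
From mathcomp Require Import ring.

Set Implicit Arguments.
Unset Strict Implicit.
Unset Printing Implicit Defensive.

Import Order.TTheory GRing.Theory Num.Theory.

Local Open Scope classical_set_scope.
Local Open Scope ring_scope.
Local Open Scope ereal_scope.

(** Write [r] for the rank, and call a set dual independent when it is almost
    everywhere disjoint from some base. A greedy exhaustion ([exists_maximal]),
    which uses closure under increasing unions and finiteness of the measure,
    extends every independent subset of [X] to a maximal one. Hence the rank is
    a well-defined maximum, and [A] is dual independent exactly when the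
    complement of [A] has full rank ([dual_rankP]).

    Dual independence passes to the union [U] of an increasing sequence [A i]
    because removing a set from [X] lowers [r X] by at most the measure of that
    set ([rank_le_setD]). The complement of [U] arises from that of [A i], whose
    rank is full, by removing a set whose measure tends to 0 ([dual_bigcup]).

    The remaining axiom and the rank formula come from one computation
    ([measure_dual_maximal]). Let [A] be maximal among the dual independent
    subsets of [S]. Extend a maximal independent subset of the complement of [S]
    to a maximal independent subset [G] of the complement of [A]. Then [G] is a
    base, with measure [r (~` S)] outside [S], and maximality of [A] makes it
    equal to [S `\` G]. So [mu A] is [mu S] minus the measure
    [r setT - r (~` S)] of [G] inside [S], whatever the choice of [A]. *)

(** * Inclusion up to null sets *)

Section AeSubset.
Context {R : realType} {d : measure_display} {J : measurableType d}.
Variable mu : {finite_measure set J -> \bar R}.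
Implicit Types A B C X : set J.

Local Notation "A <=ae B" := (ae_subset mu A B) (at level 70).

Lemma measure_fin A : measurable A -> mu A \is a fin_num.
Proof. exact: fin_num_measure. Qed.

Lemma measure_setDI A B : measurable A -> measurable B ->
  mu A = mu (A `\` B) + mu (A `&` B).
Proof. exact: measureDI. Qed.

Lemma ae_subsetP A B : measurable A -> measurable B ->
  A <=ae B <-> mu.-negligible (A `\` B).
Proof. by move=> mA mB; rewrite negligibleP//; exact: measurableD. Qed.

Lemma subset_ae A B : A `<=` B -> A <=ae B.
Proof. by rewrite -setD_eq0 /ae_subset => ->; rewrite measure0. Qed.

Lemma ae_subset_refl A : A <=ae A.
Proof. exact: subset_ae. Qed.

Lemma ae_subset_trans B A C : measurable A -> measurable B -> measurable C ->
  A <=ae B -> B <=ae C -> A <=ae C.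
Proof.
move=> mA mB mC /(ae_subsetP mA mB) AB /(ae_subsetP mB mC) BC.
apply/(ae_subsetP mA mC); apply: negligibleS (negligibleU AB BC).
by move=> x [Ax nCx]; have [Bx|nBx] := pselect (B x); [right|left].
Qed.

Lemma ae_subsetC A B : A <=ae B -> ~` B <=ae ~` A.
Proof. by rewrite /ae_subset !setDE setCK setIC. Qed.

Lemma ae_subsetCl A B : ~` A <=ae B -> ~` B <=ae A.
Proof. by move=> /ae_subsetC; rewrite setCK. Qed.

Lemma ae_subsetCr A B : A <=ae ~` B -> B <=ae ~` A.
Proof. by move=> /ae_subsetC; rewrite setCK. Qed.

Lemma ae_subsetI A B C : measurable A -> measurable B -> measurable C ->
  C <=ae A -> C <=ae B -> C <=ae A `&` B.
Proof.
move=> mA mB mC /(ae_subsetP mC mA) CA /(ae_subsetP mC mB) CB.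
apply/ae_subsetP => //; first exact: measurableI.
apply: negligibleS (negligibleU CA CB) => x [Cx /not_andP[nA|nB]].
  by left.
by right.
Qed.

Lemma ae_subset_bigcup (A : (set J)^nat) X :
  (forall i, measurable (A i)) -> measurable X ->
  (forall i, A i <=ae X) -> \bigcup_i A i <=ae X.
Proof.
move=> mA mX AX; apply/ae_subsetP => //; first exact: bigcup_measurable.
rewrite setDE setI_bigcupl; apply: negligible_bigcup => i.
by rewrite -setDE; apply/ae_subsetP.
Qed.

Lemma ae_subset_le A B : measurable A -> measurable B ->
  A <=ae B -> mu A <= mu B.
Proof.
move=> mA mB; rewrite /ae_subset (measure_setDI mA mB) => ->.
rewrite add0e; apply: le_measure; rewrite ?inE//; exact: measurableI.
Qed.

Lemma ae_subset_eq A B : measurable A -> measurable B ->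
  A <=ae B -> B <=ae A -> mu A = mu B.
Proof.
by move=> mA mB AB BA; apply/eqP; rewrite eq_le !ae_subset_le.
Qed.

(** Finiteness of the measure enters here: a set that is no larger than an
    almost everywhere subset of it leaves nothing outside that subset. *)
Lemma ae_subset_le_rev A B : measurable A -> measurable B ->
  A <=ae B -> mu B <= mu A -> B <=ae A.
Proof.
move=> mA mB; rewrite /ae_subset (measure_setDI mA mB) => -> BA.
apply/eqP; rewrite eq_le measure_ge0 andbT.
have mAB : measurable (A `&` B) by exact: measurableI.
move: BA; rewrite (measure_setDI mB mA) add0e (setIC B A).
by rewrite -leeBrDr ?measure_fin// subee ?measure_fin.
Qed.

(** Replacing [A n] by the union of [A 0], ..., [A n], which differs from it by
    a null set, turns the almost everywhere increasing sequence into an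
    increasing one, to which continuity from below applies. *)
Lemma measure_bigcup_le (A : (set J)^nat) c :
  (forall i, measurable (A i)) -> (forall i, A i <=ae A i.+1) ->
  (forall i, mu (A i) <= c) -> mu (\bigcup_i A i) <= c.
Proof.
move=> mA incA Ac; rewrite -bigcup_bigsetU_bigcup.
have mU n : measurable (\big[setU/set0]_(i < n.+1) A i).
  exact: bigsetU_measurable.
have UA n : \big[setU/set0]_(i < n.+1) A i <=ae A n.
  elim: n => [|n IHn].
    by rewrite big_ord_recr big_ord0/= set0U; exact: ae_subset_refl.
  have {}IHn := ae_subset_trans (mU n) (mA n) (mA n.+1) IHn (incA n).
  by rewrite big_ord_recr/= /ae_subset setDUl setDv setU0.
have cvgU : (mu \o (fun n => \big[setU/set0]_(i < n.+1) A i)) @ \oo -->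
    mu (\bigcup_n \big[setU/set0]_(i < n.+1) A i).
  apply: nondecreasing_cvg_mu => //; first exact: bigcup_measurable.
  by move=> n m nm; apply/subsetPset; exact: subset_bigsetU.
rewrite -(cvg_lim _ cvgU)//; apply: lime_le.
  by apply/cvg_ex; exists (mu (\bigcup_n \big[setU/set0]_(i < n.+1) A i)).
apply: nearW => n /=.
exact: le_trans (ae_subset_le (mU n) (mA n) (UA n)) (Ac n).
Qed.

(** * Maximal members *)

(** A greedy exhaustion: each step chooses an extension whose measure is within
    1/(n+1) of the supremum of the measures of all extensions. Nothing can be
    added to the union of the resulting sequence, since any further extension
    also extends every term of the sequence. *)
Lemma exists_maximal (P : set (set J)) :
  P `<=` measurable ->
  (forall A : (set J)^nat, (forall i, P (A i)) ->
    (forall i, A i <=ae A i.+1) -> P (\bigcup_i A i)) ->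
  forall A, P A -> exists2 B, maximal_in mu P B & A <=ae B.
Proof.
move=> Pm PU A0 PA0.
pose good (n : nat) A B := [/\ P B, A <=ae B &
  forall C, P C -> A <=ae C -> mu C <= mu B + (n.+1%:R^-1)%:E].
(* [P nA.2] is a premise of the relation, so that [next] below is total. *)
have step (nA : nat * set J) : exists B, P nA.2 -> good nA.1 nA.2 B.
  case: nA => n A /=; have [PA|] := pselect (P A); last by exists A.
  pose S := [set mu C | C in [set C | P C /\ A <=ae C]].
  have supS C : P C -> A <=ae C -> mu C <= ereal_sup S.
    by move=> PC sAC; apply: ereal_sup_ubound; exists C.
  have finS : ereal_sup S \is a fin_num.
    apply/fin_numPlt/andP; split.
      apply: lt_le_trans (supS A PA (ae_subset_refl A)).
      by rewrite ltNye_eq measure_fin//; exact: Pm.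
    apply: le_lt_trans (_ : mu setT < +oo); last by rewrite ltey_eq measure_fin.
    apply: ge_ereal_sup => _ [C [PC _] <-].
    by apply: le_measure; rewrite ?inE//; exact: Pm.
  have e0 : (0 < n.+1%:R^-1 :> R)%R by rewrite invr_gt0.
  have [_ [B [PB AB] <-] supB] := ub_ereal_sup_adherent e0 finS.
  exists B => _; split=> // C PC sAC; apply: le_trans (supS C PC sAC) _.
  by rewrite -leeBlDr// ltW.
have [next nextP] := choice step.
pose A := fix A n := if n is m.+1 then next (m, A m) else A0.
have PA n : P (A n) by elim: n => // n /(nextP (n, A n))[].
have AP n : good n (A n) (A n.+1) by exact: (nextP (n, A n) (PA n)).
have PAU : P (\bigcup_i A i) by apply: PU => // i; have [] := AP i.
exists (\bigcup_i A i); last by apply: subset_ae => x A0x; exists 0%N.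
have AU n : A n <=ae \bigcup_i A i.
  by apply: subset_ae => x Anx; exists n.
split=> // B PB UB; apply: ae_subset_le_rev => //; try exact: Pm.
apply/lee_addgt0Pr => e e0.
have [n ne] : exists n, (n.+1%:R^-1 < e)%R.
  exists (Num.truncn e^-1); rewrite invf_plt ?posrE//.
  by rewrite truncnS_gt.
have [_ _ /(_ B PB)] := AP n.
move=> /(_ (ae_subset_trans (Pm _ (PA n)) (Pm _ PAU) (Pm _ PB) (AU n) UB)) BA.
apply: le_trans BA _; apply: leeD; last by rewrite lee_fin ltW.
by apply: ae_subset_le => //; exact: Pm.
Qed.

End AeSubset.

(** * Ranks in a measurable matroid *)

Section Rank.
Context {R : realType} {d : measure_display} {J : measurableType d}.
Variable mu : {finite_measure set J -> \bar R}.
Variable Fam : set (set J).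
Hypothesis M : measurable_matroid mu Fam.
Implicit Types A B X Y : set J.

Local Notation "A <=ae B" := (ae_subset mu A B) (at level 70).
Local Notation basis_in X := (maximal_in mu (restrict_family mu Fam X)).
Local Notation r := (rank mu Fam).

Let indepm A : Fam A -> measurable A.
Proof. exact: (indep_measurable M). Qed.

Lemma exists_basis_in X A : measurable X -> Fam A -> A <=ae X ->
  exists2 B, basis_in X B & A <=ae B.
Proof.
move=> mX FA AX; apply: exists_maximal => //; first by move=> B [/indepm].
move=> B FB incB; split.
  by apply: (indep_bigcup M) => // i; have [] := FB i.
by apply: ae_subset_bigcup => // i; have [/indepm] := FB i.
Qed.

Lemma rank_basis X B : measurable X -> basis_in X B -> r X = mu B.
Proof.
move=> mX XB; apply: (indep_maximal M mX) => //.
exact: (xgetPex set0 (ex_intro _ B XB)).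
Qed.

Lemma indep_le_rank X A : measurable X -> Fam A -> A <=ae X -> mu A <= r X.
Proof.
move=> mX FA AX; have [B XB AB] := exists_basis_in mX FA AX.
rewrite (rank_basis mX XB) ae_subset_le//; first exact: indepm.
by case: XB => -[/indepm].
Qed.

Lemma rank_witness X : measurable X ->
  exists B, [/\ Fam B, B <=ae X & r X = mu B].
Proof.
move=> mX.
have [B XB _] :=
  exists_basis_in mX (indep_set0 M) (subset_ae mu (@sub0set _ X)).
by exists B; rewrite (rank_basis mX XB); case: XB => -[].
Qed.

Lemma rank_fin X : measurable X -> r X \is a fin_num.
Proof.
by move=> /rank_witness[B [/indepm mB _ ->]]; exact: measure_fin.
Qed.

Lemma rank_mono X Y : measurable X -> measurable Y -> X <=ae Y -> r X <= r Y.
Proof.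
move=> mX mY XY; have [B [FB BX ->]] := rank_witness mX.
apply: indep_le_rank => //; apply: ae_subset_trans BX XY => //; exact: indepm.
Qed.

(** A maximal independent subset of [X] splits along [Y], and its part inside
    [Y] is independent. *)
Lemma rank_le_setD X Y : measurable X -> measurable Y ->
  r X <= r Y + mu (X `\` Y).
Proof.
move=> mX mY; have [B [FB BX ->]] := rank_witness mX.
have mB := indepm FB; rewrite (measure_setDI mu mB mY) addeC; apply: leeD.
  apply: indep_le_rank => //; last by apply: subset_ae => x [].
  apply: (indep_subset M) FB _; first exact: measurableI.
  by apply: subset_ae => x [].
apply: ae_subset_le; try exact: measurableD.
rewrite setDE; apply: ae_subsetI => //; first exact: measurableC.
- exact: measurableD.
- apply: ae_subset_trans BX => //; first exact: measurableD.
  by apply: subset_ae => x [].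
- by apply: subset_ae => x [].
Qed.

(** An independent set as large as a base leaves no room for an extension, since
    the measure is finite. *)
Lemma basesP B : bases mu Fam B <-> Fam B /\ mu B = r setT.
Proof.
split=> [[FB maxB]|[FB Br]].
  split=> //; apply/esym/rank_basis => //; split.
    by split=> //; exact: subset_ae.
  by move=> A [FA _]; exact: maxB.
split=> // A FA BA; apply: ae_subset_le_rev => //; try exact: indepm.
by rewrite Br; apply: indep_le_rank => //; exact: subset_ae.
Qed.

Lemma indep_sub_base A : Fam A -> exists2 B, bases mu Fam B & A <=ae B.
Proof.
move=> FA; apply: exists_maximal FA => //; exact: (indep_bigcup M).
Qed.

Lemma indep_of_bases_bases : indep_of_bases mu (bases mu Fam) = Fam.
Proof.
apply/seteqP; split=> [A [mA [B [FB _] AB]]|A FA].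
  exact: (indep_subset M) AB.
by split; [exact: indepm|exact: indep_sub_base].
Qed.

(** * The dual matroid *)

Local Notation dual := (indep_of_bases mu (dual_bases (bases mu Fam))).

Lemma dualP A : dual A <->
  measurable A /\ exists2 B, bases mu Fam B & A <=ae ~` B.
Proof.
split=> -[mA].
  by move=> [B [mB baseB] AB]; split=> //; exists (~` B); rewrite ?setCK.
move=> [B baseB AB]; split=> //; exists (~` B) => //.
by split; rewrite ?setCK//; apply: measurableC; apply: indepm; case: baseB.
Qed.

(** A base [B] disjoint from [A] is a subset of the complement of [A] of measure
    [r setT]; conversely an independent set of that measure is a base. Dual
    independence thus becomes a condition on ranks, which can be estimated. *)
Lemma dual_rankP A : measurable A -> (dual A <-> r (~` A) = r setT).
Proof.
move=> mA; have mCA : measurable (~` A) by exact: measurableC.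
split=> [/dualP[_ [B /basesP[FB Br] AB]]|rA].
  apply/eqP; rewrite eq_le rank_mono//=; last exact: subset_ae.
  by rewrite -Br indep_le_rank//; exact: ae_subsetCr.
have [B [FB BA rB]] := rank_witness mCA.
apply/dualP; split=> //; exists B; last exact: ae_subsetCr.
by apply/basesP; rewrite -rB.
Qed.

Lemma dual_subset A B : measurable A -> dual B -> A <=ae B -> dual A.
Proof.
move=> mA [mB [C [mC baseC] BC]] AB; split=> //; exists C => //.
exact: ae_subset_trans AB BC.
Qed.

(** The complements of an increasing sequence of dual independent sets [A i]
    decrease and all have full rank. Their intersection loses at most
    [mu (\bigcup_j A j `\` A i)] of it, which tends to 0. *)
Lemma dual_bigcup (A : (set J)^nat) : (forall i, dual (A i)) ->
  (forall i, A i <=ae A i.+1) -> dual (\bigcup_i A i).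
Proof.
move=> dA incA; have mA i : measurable (A i) by case: (dA i).
set U := \bigcup_i A i; have mU : measurable U by exact: bigcup_measurable.
have mCU : measurable (~` U) by exact: measurableC.
apply/dual_rankP => //; apply/eqP.
rewrite eq_le rank_mono//=; last exact: subset_ae.
have fU := rank_fin mCU; have fT := rank_fin (@measurableT _ J).
suff : mu U <= r (~` U) + mu U - r setT.
  by rewrite leeBrDr// addeC leeD2rE// ?measure_fin.
apply: measure_bigcup_le => // i.
have mCA : measurable (~` A i) by exact: measurableC.
have := rank_le_setD mCA mCU; rewrite ((dual_rankP (mA i)).1 (dA i)).
have -> : ~` A i `\` ~` U = U `\` A i by rewrite !setDE setCK setIC.
have AU : U `&` A i = A i by apply/setIidPr => x Ax; exists i.
rewrite (measure_setDI mu mU (mA i)) AU leeBrDr//.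
by rewrite (addeC (mu (A i))) addeA => rA; exact: leeD2r.
Qed.

(** Extend a basis [F] of the complement of [S] to a basis [G] of the complement
    of [A], which has full rank. The complement of [G] in [S] is dual
    independent and contains [A], so equals [A] by maximality; and [G] has
    measure [r (~` S)] outside [S], as [F] is maximal there. *)
Lemma measure_dual_maximal S A : measurable S ->
  maximal_in mu (restrict_family mu dual S) A ->
  mu A = mu S - r setT + r (~` S).
Proof.
move=> mS [[dA AS] maxA]; have [mA _] := dA.
have mCS : measurable (~` S) by exact: measurableC.
have mCA : measurable (~` A) by exact: measurableC.
have [F [FF FS rF]] := rank_witness mCS; have mF := indepm FF.
have FA : F <=ae ~` A by apply: ae_subset_trans FS (ae_subsetC AS).
have [G GA FG] := exists_basis_in mCA FF FA.
have rG : mu G = r setT by rewrite -(rank_basis mCA GA); exact/dual_rankP.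
case: GA => -[FamG GA] _; have mG := indepm FamG.
have mCG : measurable (~` G) by exact: measurableC.
have mSG : measurable (S `\` G) by exact: measurableD.
have dSG : dual (S `\` G).
  apply/dualP; split=> //; exists G; first exact/basesP.
  by apply: subset_ae => x [].
have ASG : A <=ae S `\` G.
  by rewrite setDE; apply: ae_subsetI => //; exact: ae_subsetCr.
have SGA : S `\` G <=ae A.
  by apply: maxA => //; split=> //; apply: subset_ae => x [].
have mGS : measurable (G `\` S) by exact: measurableD.
have GSF : mu (G `\` S) = r (~` S).
  apply/eqP; rewrite eq_le; apply/andP; split.
    apply: indep_le_rank => //; last by apply: subset_ae => x [].
    by apply: (indep_subset M) FamG _ => //; apply: subset_ae => x [].
  by rewrite rF; apply: ae_subset_le => //; rewrite setDE; exact: ae_subsetI.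
have mI : measurable (S `&` G) by exact: measurableI.
rewrite (ae_subset_eq mA mSG ASG SGA) -rG -GSF.
rewrite (measure_setDI mu mS mG) (measure_setDI mu mG mS) (setIC G S).
move: (measure_fin mu mSG) (measure_fin mu mI) (measure_fin mu mGS).
move=> /fineK <- /fineK <- /fineK <-.
rewrite -!(EFinD, EFinN); congr EFin; ring.
Qed.

Lemma measurable_matroid_dual : measurable_matroid mu dual.
Proof.
split.
- by move=> A [].
- have [B baseB _] := indep_sub_base (indep_set0 M).
  by apply/dualP; split=> //; exists B => //; exact: subset_ae.
- exact: dual_subset.
- move=> S A B mS SA SB.
  by rewrite (measure_dual_maximal mS SA) (measure_dual_maximal mS SB).
- exact: dual_bigcup.
Qed.

Lemma bases_dual : bases mu dual = dual_bases (bases mu Fam).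
Proof.
apply/seteqP; split=> B.
  move=> [/[dup] dB /dualP[mB [C baseC BC]] maxB].
  have [/indepm mC rC] := (basesP C).1 baseC.
  have mCB : measurable (~` B) by exact: measurableC.
  have CB : ~` C <=ae B.
    apply: maxB => //; apply/dualP; split; first exact: measurableC.
    by exists C => //; exact: ae_subset_refl.
  split=> //; apply/basesP; split.
    by apply: (indep_subset M) (proj1 baseC) _ => //; exact: ae_subsetCl.
  rewrite -rC; apply: ae_subset_eq => //; first exact: ae_subsetCl.
  exact: ae_subsetCr.
move=> [mB baseB]; split.
  apply/dualP; split=> //; exists (~` B) => //.
  by rewrite setCK; exact: ae_subset_refl.
move=> A /dualP[mA [C baseC AC]] BA.
have [FC _] := baseC; have mC := indepm FC.
have mCC : measurable (~` C) by exact: measurableC.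
have CB : C <=ae ~` B by apply: ae_subsetCr; exact: ae_subset_trans BA AC.
have BC : ~` B <=ae C by case: baseC => _; apply => //; case: baseB.
by apply: ae_subset_trans AC _ => //; exact: ae_subsetCl.
Qed.

End Rank.

Theorem proposition4p4 (R : realType) (d : measure_display)
    (J : measurableType d) (mu : {finite_measure set J -> \bar R})
    (Bs : set (set J)) :
  standard_measure_space mu ->
  matroid_bases mu Bs ->
  matroid_bases mu (dual_bases Bs) /\
  (forall S : set J, measurable S ->
     rank_of_bases mu (dual_bases Bs) S =
       mu S - rank_of_bases mu Bs setT + rank_of_bases mu Bs (~` S)).
Proof.
move=> _ [Fam M <-]; have M' := measurable_matroid_dual M; split.
  exists (indep_of_bases mu (dual_bases (bases mu Fam))) => //.
  exact: bases_dual.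
move=> S mS; rewrite /rank_of_bases (indep_of_bases_bases M).
have [B SB _] :=
  exists_basis_in M' mS (indep_set0 M') (subset_ae mu (@sub0set _ S)).
by rewrite (rank_basis M' mS SB); exact: measure_dual_maximal.
Qed.
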